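(* For every positive integer $m$, $$A_{2m+1}^+(s,t)=(s+t)A_{2m}^+(s,t)+st\,D A_{2m}^+(s,t),\qquad A_{2m+1}^-(s,t)=(s+t)A_{2m}^-(s,t)+st\,D A_{2m}^-(s,t),$$ where $D=\frac{\partial}{\partial s}+\frac{\partial}{\partial t}$.
   Context: For a permutation $\pi=\pi_1\cdots\pi_n$ of $[n]$ let $\mathsf{des}(\pi)=|\{i\in[n-1]:\pi_i>\pi_{i+1}\}|$ and $\mathsf{asc}(\pi)=n-1-\mathsf{des}(\pi)$. Let $\mathfrak{S}_n$ be the symmetric group and $\mathcal{A}_n$ the alternating group. $A_n^+(s,t)=\sum_{\pi\in\mathcal{A}_n}t^{\mathsf{des}(\pi)}s^{\mathsf{asc}(\pi)}$ and $A_n^-(s,t)=\sum_{\pi\in\mathfrak{S}_n\setminus\mathcal{A}_n}t^{\mathsf{des}(\pi)}s^{\mathsf{asc}(\pi)}$. *)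

(* Defs.v *)
From HB Require Import structures.
From mathcomp Require Import all_boot all_order all_algebra all_fingroup all_solvable.
From mathcomp Require Import mpoly.

Set Implicit Arguments.
Unset Strict Implicit.
Unset Printing Implicit Defensive.

Import GRing.Theory.

(* A permutation of {1, ..., n} is p : 'S_n = {perm 'I_n}, shifted to
   {0, ..., n-1}: the letter pi_(i+1) is (p i) + 1. *)
Definition des (n : nat) (p : 'S_n) : nat :=
  #|[set i : 'I_n | [exists j : 'I_n, (j == i.+1 :> nat) && (p i > p j)]]|.

Definition asc (n : nat) (p : 'S_n) : nat := n - 1 - des p.

Local Open Scope ring_scope.

Definition s : {mpoly int[2]} := 'X_(0 : 'I_2).
Definition t : {mpoly int[2]} := 'X_(1 : 'I_2).

Definition Aplus (n : nat) : {mpoly int[2]} :=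
  \sum_(p : 'S_n | p \in ('Alt_('I_n))%g) t ^+ des p * s ^+ asc p.

Definition Aminus (n : nat) : {mpoly int[2]} :=
  \sum_(p : 'S_n | p \notin ('Alt_('I_n))%g) t ^+ des p * s ^+ asc p.

(* d/ds + d/dt: s and t are the variables of index 0 and 1. *)
Definition D (f : {mpoly int[2]}) : {mpoly int[2]} :=
  mderiv (0 : 'I_2) f + mderiv (1 : 'I_2) f.

(* Main.v *)
(* Build each permutation of 2m+1 letters by inserting the maximum at some
   position i of a permutation p of 2m letters. Summed over i, the weights of
   the insertions are (s + t) w + s t D w, with w the weight of p. Insertion at
   i multiplies the sign by (-1)^i, so it remains to see that for odd i the even
   and the odd p have the same total weight after insertion. An odd number of
   letters lies to the left of the maximum, so some pair of values 2k, 2k+1 is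
   separated by it; exchanging the first such pair changes the sign but no
   descent, because the two values are consecutive and not in adjacent
   positions, and it is an involution. *)

Require Import Defs.
From mathcomp Require Import all_boot all_order all_algebra all_fingroup all_solvable.
From mathcomp Require Import mpoly.
From mathcomp Require Import zify ring.

Set Implicit Arguments.
Unset Strict Implicit.
Unset Printing Implicit Defensive.

Import GRing.Theory.

Local Open Scope nat_scope.

(** * Descents position by position *)

Definition descent_at (n : nat) (p : 'S_n) (i : 'I_n) : bool :=
  [exists j : 'I_n, (j == i.+1 :> nat) && (p i > p j)].

Lemma des_sum (n : nat) (p : 'S_n) : des p = \sum_(i < n) descent_at p i.
Proof.
rewrite /des -sum1_card big_mkcond /=; apply: eq_bigr => i _.
by rewrite inE /descent_at; case: [exists _, _].
Qed.

Lemma descent_atE (n : nat) (p : 'S_n) (i j : 'I_n) :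
  j = i.+1 :> nat -> descent_at p i = (p i > p j).
Proof.
move=> ji; apply/existsP/idP => [[k /andP[/eqP ki]]|lt_ji].
  by have -> : k = j by apply: val_inj; rewrite /= ki ji.
by exists j; rewrite ji eqxx.
Qed.

Lemma descent_at_last (n : nat) (p : 'S_n) (i : 'I_n) :
  i.+1 = n -> descent_at p i = false.
Proof.
by move=> iE; apply/existsP => -[j /andP[/eqP ji _]]; have := ltn_ord j; lia.
Qed.

Lemma des_le (n : nat) (p : 'S_n.+1) : des p <= n.
Proof.
rewrite des_sum big_ord_recr /= descent_at_last //= addn0.
rewrite -[leqRHS]card_ord -sum1_card; apply: leq_sum => i _.
exact: leq_b1.
Qed.

(** * Insertion of the maximum *)

Lemma descent_at_insert (n : nat) (i : 'I_n.+1) (p : 'S_n) :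
  descent_at (lift_perm i ord_max p) i = (i < n).
Proof.
case: (ltnP i n) => [lt_in|le_ni]; last first.
  by rewrite descent_at_last //; have := ltn_ord i; lia.
rewrite (@descent_atE _ _ _ (lift i (Ordinal lt_in))) /=; last first.
  by rewrite /bump leqnn.
rewrite lift_perm_id lift_perm_lift lift_max; exact: ltn_ord.
Qed.

(** For [k.+1 = i] the letter is now followed by the maximum, an ascent; every other adjacent pair
    stays adjacent. *)
Lemma descent_at_insert_lift (n : nat) (i : 'I_n.+1) (p : 'S_n) (k : 'I_n) :
  descent_at (lift_perm i ord_max p) (lift i k) =
  (k.+1 != i) && descent_at p k.
Proof.
case: (eqVneq k.+1 i) => [ki|ki] /=.
  rewrite (@descent_atE _ _ _ i) /= ?/bump -?ki ?ltnn //.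
  rewrite lift_perm_id lift_perm_lift lift_max /=.
  by rewrite ltnNge ltnW // ltn_ord.
case: (ltnP k.+1 n) => [lt_kn|le_nk].
  rewrite (@descent_atE _ _ _ (lift i (Ordinal lt_kn))) /=; last first.
    by rewrite /bump; move/eqP: ki; case: leqP; case: leqP; lia.
  by rewrite !lift_perm_lift !lift_max (@descent_atE _ _ _ (Ordinal lt_kn)).
have kE : k.+1 = n by have := ltn_ord k; lia.
rewrite !descent_at_last //= /bump.
by have := ltn_ord i; move/eqP: ki; case: leqP; lia.
Qed.

Lemma des_insert (n : nat) (i : 'I_n.+1) (p : 'S_n) :
  des (lift_perm i ord_max p) =
  (i < n) + \sum_(k < n | k.+1 != i) descent_at p k.
Proof.
rewrite des_sum (bigD1_ord i) //= descent_at_insert; congr addn.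
rewrite [RHS]big_mkcond /=; apply: eq_bigr => k _.
by rewrite descent_at_insert_lift; case: (k.+1 != i).
Qed.

(** The position of the maximum recovers [i] and deleting it recovers [p]; surjectivity follows by
    counting. *)
Lemma lift_perm_max_bij (n : nat) :
  bijective (fun u : 'I_n.+1 * 'S_n => lift_perm u.1 ord_max u.2).
Proof.
apply: inj_card_bij => [[i p] [j q] /= eq_ij|].
  have eq_i : i = j.
    apply: (@perm_inj _ (lift_perm i ord_max p)).
    by rewrite {2}eq_ij !lift_perm_id.
  rewrite -eq_i in eq_ij *; congr pair; apply/permP => k.
  apply: (@lift_inj _ ord_max).
  by rewrite -!(lift_perm_lift i) eq_ij.
by rewrite card_prod !card_Sn card_ord factS.
Qed.

(** No value lies strictly between [a] and [a.+1], so exchanging them affects only their comparison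
    with each other. *)
Lemma ltn_tperm_succ (N : nat) (a b x y : 'I_N) :
  b = a.+1 :> nat -> x != y -> (x, y) != (a, b) -> (x, y) != (b, a) ->
  (tperm a b x < tperm a b y) = (x < y).
Proof.
move=> ba; case: tpermP => [->|->|]; case: tpermP => [->|->|];
  rewrite -?(inj_eq val_inj) ?xpair_eqE -?val_eqE /= ?ba ?eqxx //=; lia.
Qed.

(** * The sign-reversing involution *)

Section Swap.

Variables (n : nat) (i : nat).

Definition even_value (k : 'I_n.+1./2) : 'I_n.+1 := inord k.*2.
Definition odd_value (k : 'I_n.+1./2) : 'I_n.+1 := inord k.*2.+1.

Lemma even_valueE k : even_value k = k.*2 :> nat.
Proof. by rewrite inordK //; have := ltn_ord k; lia. Qed.

Lemma odd_valueE k : odd_value k = k.*2.+1 :> nat.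
Proof. by rewrite inordK //; have := ltn_ord k; lia. Qed.

(** [p^-1] gives the position of a value; the positions below [i] are those left of a maximum
    inserted at [i]. *)
Definition separated (p : 'S_n.+1) (k : 'I_n.+1./2) : bool :=
  ((p^-1)%g (even_value k) < i) (+) ((p^-1)%g (odd_value k) < i).

Definition swap_separated (p : 'S_n.+1) : 'S_n.+1 :=
  if [pick k | separated p k] is Some k
  then (p * tperm (even_value k) (odd_value k))%g else p.

(** The exchange swaps the two terms of the test for [k] and moves no other pair. Hence the same
    pair is picked again and the second exchange undoes the first. *)
Lemma separated_mul_tperm (p : 'S_n.+1) (k : 'I_n.+1./2) :
  separated (p * tperm (even_value k) (odd_value k))%g =1 separated p.
Proof.
move=> l; rewrite /separated invMg tpermV !permM.
case: (eqVneq k l) => [<-|neq_kl]; first by rewrite tpermL tpermR addbC.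
have neq : k <> l :> nat by move=> /val_inj/eqP; rewrite (negbTE neq_kl).
by rewrite !tpermD // -val_eqE /= ?even_valueE ?odd_valueE; lia.
Qed.

Lemma swap_separatedK : involutive swap_separated.
Proof.
move=> p; rewrite {2}/swap_separated.
case pickE: [pick k | separated p k] => [k|]; rewrite /swap_separated ?pickE //.
by rewrite (eq_pick (separated_mul_tperm p k)) pickE -mulgA tperm2 mulg1.
Qed.

(** Otherwise the values at positions below [i] would form whole pairs and their number [i] would be
    even; [n] odd makes the pairs exhaust all values. *)
Lemma ex_separated (p : 'S_n.+1) :
  odd n -> odd i -> i <= n.+1 -> exists k, separated p k.
Proof.
move=> odd_n odd_i le_in; apply/existsP; apply: contraT => /existsPn nsep.
pose f x := ((p^-1)%g (inord x) < i : nat).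
have f_pair k : k < n.+1./2 -> f k.*2 = f k.*2.+1.
  move=> lt_k; have := nsep (Ordinal lt_k).
  rewrite /f /separated /even_value /odd_value /=.
  by case: (_ < i); case: (_ < i).
have sum_even k : k <= n.+1./2 -> ~~ odd (\sum_(x < k.*2) f x).
  elim: k => [|k IHk] le_k; first by rewrite big_ord0.
  rewrite doubleS !big_ord_recr /= -f_pair // -addnA addnn oddD odd_double addbF.
  exact/IHk/ltnW.
have := sum_even _ (leqnn _).
suff -> : \sum_(x < n.+1./2.*2) f x = i by rewrite odd_i.
have -> : n.+1./2.*2 = n.+1 by lia.
transitivity (\sum_(x < n.+1) (x < i : nat)).
  (* Reindexing by [p] turns the count of values into a count of positions. *)
  rewrite (reindex_inj (@perm_inj _ p)); apply: eq_bigr => x _.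
  by rewrite /f inord_val permK.
rewrite -[RHS]card_ord -[RHS]sum1_card (big_ord_widen _ (fun=> 1) le_in).
by rewrite [RHS]big_mkcond; apply: eq_bigr => x _; case: (x < i).
Qed.

Lemma odd_swap_separated (p : 'S_n.+1) :
  odd n -> odd i -> i <= n.+1 -> odd_perm (swap_separated p) = ~~ odd_perm p.
Proof.
move=> odd_n odd_i le_in; have [k sep_k] := ex_separated p odd_n odd_i le_in.
rewrite /swap_separated; case: pickP => [l _|/(_ k)]; last by rewrite sep_k.
rewrite odd_permM odd_tperm -val_eqE /= even_valueE odd_valueE.
by rewrite ltn_eqF // addbT.
Qed.

(** Positions [k] and [k.+1] lie on the same side of the cut at [i], so they cannot hold the two
    exchanged values. The excluded position is the one that [des_insert] omits. *)
Lemma descent_at_swap_separated (p : 'S_n.+1) (k : 'I_n.+1) :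
  k.+1 != i -> descent_at (swap_separated p) k = descent_at p k.
Proof.
move=> ki; rewrite /swap_separated; case: pickP => [l sep_l|//].
case: (ltnP k.+1 n.+1) => [lt_kn|le_nk]; last first.
  by rewrite !descent_at_last //; have := ltn_ord k; lia.
rewrite !(@descent_atE _ _ _ (Ordinal lt_kn)) // !permM.
set j := Ordinal lt_kn; have neq_jk : j != k by rewrite -val_eqE /=; lia.
have same_side : (j < i) = (k < i) by move/eqP: ki => /=; lia.
apply: ltn_tperm_succ; rewrite ?even_valueE ?odd_valueE //.
- by rewrite (inj_eq perm_inj).
- apply/eqP => -[jE kE]; move: sep_l.
  by rewrite /separated -jE -kE !permK same_side addbb.
- apply/eqP => -[jE kE]; move: sep_l.
  by rewrite /separated -jE -kE !permK same_side addbb.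
Qed.

End Swap.

Lemma des_insert_swap_separated (n : nat) (i : 'I_n.+2) (p : 'S_n.+1) :
  des (lift_perm i ord_max (swap_separated i p)) = des (lift_perm i ord_max p).
Proof.
rewrite !des_insert; congr addn; apply: eq_bigr => k ki.
by rewrite descent_at_swap_separated.
Qed.

Local Open Scope ring_scope.

(** * Weights summed over one sign class *)

Definition weight (n : nat) (p : 'S_n) : {mpoly int[2]} :=
  t ^+ des p * s ^+ asc p.

Definition Asign (b : bool) (n : nat) : {mpoly int[2]} :=
  \sum_(p : 'S_n | odd_perm p == b) weight p.

Lemma AplusE (n : nat) : Aplus n = Asign false n.
Proof. by apply: eq_bigl => p; rewrite Alt_even eqbF_neg. Qed.

Lemma AminusE (n : nat) : Aminus n = Asign true n.
Proof. by apply: eq_bigl => p; rewrite Alt_even negbK eqb_id. Qed.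

Lemma sum_weight_insert_odd (n : nat) (i : 'I_n.+2) (b : bool) :
  odd n -> odd i ->
  \sum_(p : 'S_n.+1 | odd_perm p == ~~ b) weight (lift_perm i ord_max p) =
  \sum_(p : 'S_n.+1 | odd_perm p == b) weight (lift_perm i ord_max p).
Proof.
move=> odd_n odd_i.
rewrite (reindex_inj (inv_inj (@swap_separatedK n i))).
apply: eq_big => [p|p _].
  by rewrite odd_swap_separated ?(inj_eq negb_inj) // -ltnS.
by rewrite /weight /asc des_insert_swap_separated.
Qed.

(* For n + 1 even the inserted maximum changes the sign exactly when its
   position i is odd, and by the involution that change does not matter. *)
Lemma Asign_insert (n : nat) (b : bool) :
  odd n ->
  Asign b n.+2 =
  \sum_(p : 'S_n.+1 | odd_perm p == b)
     \sum_(i < n.+2) weight (lift_perm i ord_max p).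
Proof.
move=> odd_n; rewrite /Asign exchange_big /=.
rewrite (reindex _ (onW_bij _ (lift_perm_max_bij n.+1))) /=.
rewrite -(pair_big_dep xpredT
  (fun i p => odd_perm (lift_perm i ord_max p) == b)
  (fun i p => weight (lift_perm i ord_max p))) /=.
apply: eq_bigr => i _;
under eq_bigl => p do rewrite odd_lift_perm /= odd_n addbF.
have [odd_i|even_i] := boolP (odd i); last by [].
rewrite -(sum_weight_insert_odd b odd_n odd_i); apply: eq_bigl => p.
by case: (odd_perm p); case: b.
Qed.

(** * The operator [D], the weights of insertions and the recurrence *)

Lemma D_mul (f g : {mpoly int[2]}) : D (f * g) = D f * g + f * D g.
Proof. by rewrite /D !mderivM; ring. Qed.

(** The extra factor [f] avoids the exponent [k - 1], which would be truncated at [k = 0]. *)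
Lemma D_exp (f : {mpoly int[2]}) (k : nat) :
  D f = 1 -> f * D (f ^+ k) = k%:R * f ^+ k.
Proof.
move=> Df; elim: k => [|k IHk]; first by rewrite /D !mderivC addr0 mulr0 mul0r.
by rewrite exprS D_mul Df mulrDr mulrCA IHk -natr1; ring.
Qed.

Lemma D_var (k : 'I_2) : D 'X_k = 1.
Proof.
rewrite /D !mderivX !mnm1E; case: k => -[|[|//]] lt_k2 /=.
  rewrite scale1r scale0r addr0 (_ : (_ - _)%MM = 0%MM) ?mpolyX0 //.
  by apply/mnmP => j; rewrite mnmBE mnm0E subnn.
rewrite scale1r scale0r add0r (_ : (_ - _)%MM = 0%MM) ?mpolyX0 //.
by apply/mnmP => j; rewrite mnmBE mnm0E subnn.
Qed.

Lemma D_sum (I : Type) (r : seq I) (P : pred I) (F : I -> {mpoly int[2]}) :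
  D (\sum_(i <- r | P i) F i) = \sum_(i <- r | P i) D (F i).
Proof. by rewrite /D !raddf_sum -big_split. Qed.

Lemma mul_st_D_weight (n : nat) (p : 'S_n) :
  s * t * D (weight p) = ((des p)%:R * s + (asc p)%:R * t) * weight p.
Proof.
rewrite /weight D_mul.
have Ds := D_exp (asc p) (D_var 0); have Dt := D_exp (des p) (D_var 1).
rewrite -/s in Ds; rewrite -/t in Dt.
transitivity (s * (t * D (t ^+ des p)) * s ^+ asc p +
              t * t ^+ des p * (s * D (s ^+ asc p))); first by ring.
by rewrite Ds Dt; ring.
Qed.

(** In an ascent gap the maximum adds a descent, in a descent gap or at the very end an ascent. The
    test [k < n] singles out the end, where [descent_at] is false by default. *)
Lemma weight_insert_succ (n : nat) (p : 'S_n.+1) (k : 'I_n.+1) :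
  weight (lift_perm (lift ord0 k) ord_max p) =
  (if (k < n)%N && ~~ descent_at p k then t else s) * weight p.
Proof.
have := des_insert (lift ord0 k) p; have := des_sum p.
rewrite (bigD1 k) //= => desE desI.
(* The bound [des_le] keeps the truncated subtractions in [asc] exact. *)
rewrite /weight /asc desI; have := des_le p; rewrite desE.
have -> : (\sum_(j < n.+1 | j.+1 != lift ord0 k :> nat) descent_at p j =
  \sum_(j < n.+1 | j != k) descent_at p j)%N by [].
set d := (\sum_(j < n.+1 | j != k) _)%N; rewrite /bump /= add1n ltnS.
have [lt_kn|le_nk] /= := ltnP k n; last first.
  rewrite descent_at_last; last by have := ltn_ord k; lia.
  move=> le_dn; have -> : (n.+2 - 1 - (0 + d) = (n.+1 - 1 - (0 + d)).+1)%N by lia.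
  by rewrite exprS; ring.
case: (descent_at p k) => /= le_dn.
  have -> : (n.+2 - 1 - (1 + d) = (n.+1 - 1 - (1 + d)).+1)%N by lia.
  by rewrite exprS; ring.
have -> : (n.+2 - 1 - (1 + d) = n.+1 - 1 - (0 + d))%N by lia.
by rewrite add1n add0n exprS; ring.
Qed.

Lemma weight_insert0 (n : nat) (p : 'S_n.+1) :
  weight (lift_perm ord0 ord_max p) = t * weight p.
Proof.
rewrite /weight /asc des_insert /= -des_sum add1n exprS.
have -> : (n.+2 - 1 - (des p).+1 = n.+1 - 1 - des p)%N by lia.
by ring.
Qed.

(** The front and the end give [t] and [s]; each inner descent gap gives [s] and each ascent gap
    [t], which is what [mul_st_D_weight] counts. *)
Lemma sum_weight_insert (n : nat) (p : 'S_n.+1) :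
  \sum_(i < n.+2) weight (lift_perm i ord_max p) =
  (s + t) * weight p + s * t * D (weight p).
Proof.
rewrite big_ord_recl weight_insert0.
under eq_bigr => k _ do rewrite weight_insert_succ.
rewrite -big_distrl /= big_ord_recr /= ltnn /= mul_st_D_weight.
have desE : des p = (\sum_(k < n) descent_at p (widen_ord (leqnSn n) k))%N.
  by rewrite des_sum big_ord_recr /= descent_at_last // addn0.
have ascE : asc p = (\sum_(k < n) ~~ descent_at p (widen_ord (leqnSn n) k))%N.
  apply/eqP; rewrite /asc subn1 /= -(eqn_add2l (des p)) subnKC ?des_le //.
  rewrite desE -big_split /= -{1}(card_ord n) -sum1_card.
  by apply/eqP; apply: eq_bigr => k _; case: descent_at.
have -> : \sum_(k < n) (if (k < n)%N &&
     ~~ descent_at p (widen_ord (leqnSn n) k) then t else s) =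
   (des p)%:R * s + (asc p)%:R * t.
  rewrite desE ascE !natr_sum !big_distrl -big_split /=.
  by apply: eq_bigr => k _; rewrite ltn_ord /=; case: descent_at => /=; ring.
ring.
Qed.

Lemma Asign_rec (n : nat) (b : bool) :
  odd n ->
  Asign b n.+2 = (s + t) * Asign b n.+1 + s * t * D (Asign b n.+1).
Proof.
move=> odd_n; rewrite Asign_insert // /Asign D_sum !big_distrr -big_split /=.
by apply: eq_bigr => p _; exact: sum_weight_insert.
Qed.

Theorem theorem15 (m : nat) (m_gt0 : (0 < m)%N) :
  Aplus (2 * m + 1) = (s + t) * Aplus (2 * m) + s * t * D (Aplus (2 * m)) /\
  Aminus (2 * m + 1) = (s + t) * Aminus (2 * m) + s * t * D (Aminus (2 * m)).
Proof.
(* [Asign_rec] is indexed by the predecessor of the even length, which exists because [m] is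
   positive. *)
have [n odd_n ->] : exists2 n, odd n & (2 * m = n.+1)%N.
  by exists (2 * m).-1; lia.
by rewrite addn1 !AplusE !AminusE !Asign_rec.
Qed.
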